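(* Let $\{X_n:n\in\mathbb{N}\}$ be a sequence of nonzero Banach spaces with the Daugavet property, let $1<p<\infty$, and write $X_p:=\left[\bigoplus_{n=1}^{\infty}X_n\right]_{\ell_p}$. Then $\mathrm{SCD}(B_{X_p})=\{0\}$.
   Context: Banach spaces are over $\mathbb{K}=\mathbb{R}$ or $\mathbb{C}$; $B_X$ and $X^*$ denote the closed unit ball and the topological dual of $X$. A slice of a bounded set $A\subseteq X$ is a non-empty intersection of $A$ with an open half-space; it can be written as $S(A,x^*,\alpha)=\{x\in A:\operatorname{Re}x^*(x)>\sup_{b\in A}\operatorname{Re}x^*(b)-\alpha\}$ with $x^*\in X^*$, $\alpha>0$. Let $A\subseteq X$ be bounded and convex and $a\in A$. A countable collection $\{V_n:n\in\mathbb{N}\}$ of non-empty subsets of $A$ is determining for $a$ if $a\in\overline{\mathrm{conv}}(B)$ whenever $B\subseteq A$ intersects all the sets $V_n$. The point $a$ is an SCD point (slicely countably determined point) of $A$ if there is a sequence of slices of $A$ that is determining for $a$; $\mathrm{SCD}(A)$ is the set of all SCD points of $A$. A Banach space $X$ has the Daugavet property if $\|\mathrm{Id}+T\|=1+\|T\|$ for every rank-one bounded linear operator $T:X\to X$, where $\mathrm{Id}$ is the identity operator. $\left[\bigoplus_{n=1}^{\infty}X_n\right]_{\ell_p}$ is the Banach space of all $(x_n)\in\prod_{n=1}^\infty X_n$ with $\|(x_n)\|:=\left(\sum_{n=1}^\infty\|x_n\|^p\right)^{1/p}<\infty$. *)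

(* Defs.v *)
From HB Require Import structures.
From mathcomp Require Import all_boot all_order all_algebra.
From mathcomp Require Import all_classical all_reals all_analysis.
From mathcomp Require Import complex.

Set Implicit Arguments.
Unset Strict Implicit.
Unset Printing Implicit Defensive.

Import Order.TTheory GRing.Theory Num.Theory.
Import numFieldNormedType.Exports.

Local Open Scope classical_set_scope.
Local Open Scope ring_scope.

(* Selects the scalar field: R or R[i]. *)
Inductive scalar_kind := RealScalars | ComplexScalars.

Definition scalar_field (R : realType) (k : scalar_kind) : numFieldType :=
  match k with
  | RealScalars => R
  | ComplexScalars => R[i]
  end.

Definition Rescalar (R : realType) (k : scalar_kind) : scalar_field R k -> R :=
  match k with
  | RealScalars => fun z : R => z
  | ComplexScalars => fun z : R[i] => complex.Re z
  end.

Definition scalar_of (R : realType) (k : scalar_kind) : R -> scalar_field R k :=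
  match k with
  | RealScalars => fun a : R => a
  | ComplexScalars => fun a : R => (a +i* 0)%C : R[i]
  end.

(* The library norm `|x| is a nonnegative element of the scalar field. *)
Definition rnorm (R : realType) (k : scalar_kind)
  (X : normedModType (scalar_field R k)) (x : X) : R := Rescalar `|x|.

Section scalar_lemmas.
Variables (R : realType) (k : scalar_kind).
Local Notation K := (scalar_field R k).

Lemma Rescalar_norm (X : normedModType K) (x : X) :
  scalar_of k (rnorm x) = `|x|.
Proof.
rewrite /rnorm; move: (normr_ge0 x); move: `|x|.
case: k => //= -[a b]; rewrite lecE /= => /andP[/eqP -> _] //.
Qed.

Lemma scalar_ofD (a b : R) : scalar_of k (a + b) = scalar_of k a + scalar_of k b.
Proof. by case: k => //=; rewrite /GRing.add /= addr0. Qed.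

Lemma scalar_ofM (a b : R) : scalar_of k (a * b) = scalar_of k a * scalar_of k b.
Proof.
case: k => //=; rewrite [RHS]/GRing.mul /= !mul0r !mulr0 subr0 addr0 //.
Qed.

Lemma ler_scalar_of (a b : R) : (scalar_of k a <= scalar_of k b) = (a <= b).
Proof. by case: k => //=; rewrite lecE /= eqxx. Qed.

Lemma scalar_of_inj : injective (@scalar_of R k).
Proof. by case: k => //= a b [->]. Qed.

Lemma scalar_of0 : scalar_of k 0 = 0 :> K.
Proof. by case: k. Qed.

Lemma rnorm_ge0 (X : normedModType K) (x : X) : 0 <= rnorm x.
Proof. by rewrite -ler_scalar_of Rescalar_norm scalar_of0. Qed.

Lemma ler_rnormD (X : normedModType K) (x y : X) :
  rnorm (x + y) <= rnorm x + rnorm y.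
Proof. by rewrite -ler_scalar_of scalar_ofD !Rescalar_norm ler_normD. Qed.

Lemma rnormZ (X : normedModType K) (a : K) (x : X) :
  rnorm (a *: x) = rnorm (a : K^o) * rnorm x.
Proof. by apply: scalar_of_inj; rewrite scalar_ofM !Rescalar_norm normrZ. Qed.

Lemma rnorm0_eq0 (X : normedModType K) (x : X) : rnorm x = 0 -> x = 0.
Proof.
move=> x0; apply/eqP; rewrite -normr_eq0 -Rescalar_norm x0 scalar_of0 //.
Qed.

Lemma rnorm0 (X : normedModType K) : rnorm (0 : X) = 0.
Proof. by apply: scalar_of_inj; rewrite Rescalar_norm normr0 scalar_of0. Qed.

End scalar_lemmas.

Section minkowski_sequences.
Variables (R : realType) (p : R) (p1 : 1 <= p).
Implicit Types a b : nat -> R.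
Local Open Scope ereal_scope.

Let p0 : p != 0%R. Proof. by rewrite gt_eqF// (lt_le_trans _ p1). Qed.

Lemma Lnorm_counting a :
  (forall n, (0 <= a n)%R) ->
  Lnorm counting p%:E (EFin \o a) = (\sum_(n <oo) (a n `^ p)%:E) `^ p^-1.
Proof.
move=> a0; rewrite unlock /Lnorm /=; congr (_ `^ _).
rewrite ge0_integral_count; last by move=> n; rewrite lee_fin powR_ge0.
by apply: eq_eseriesr => n _; rewrite ger0_norm.
Qed.

Lemma minkowski_series a b :
  (forall n, 0 <= a n)%R -> (forall n, 0 <= b n)%R ->
  (\sum_(n <oo) ((a n + b n) `^ p)%:E) `^ p^-1 <=
  (\sum_(n <oo) (a n `^ p)%:E) `^ p^-1 + (\sum_(n <oo) (b n `^ p)%:E) `^ p^-1.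
Proof.
move=> a0 b0; rewrite -!Lnorm_counting//; last by move=> n; rewrite addr_ge0.
exact: minkowski_EFin.
Qed.

End minkowski_sequences.

Section p_mass.
Variables (R : realType) (k : scalar_kind).
Local Notation K := (scalar_field R k).
Variables (X : nat -> normedModType K) (p : R) (p1 : 1 <= p).
Implicit Types x y : forall n, X n.

(* p_mass and lp_norm are locked because unification diverges when it unfolds
   them; rnorm_lp below gives the norm of the sum explicitly. *)
Fact p_mass_key : unit. Proof. exact: tt. Qed.
Definition p_mass : (forall n, X n) -> \bar R :=
  locked_with p_mass_key (fun x => (\sum_(n <oo) (rnorm (x n) `^ p)%:E)%E).

Lemma p_massE x : p_mass x = (\sum_(n <oo) (rnorm (x n) `^ p)%:E)%E.
Proof. by rewrite /p_mass unlock. Qed.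

Lemma p_mass_ge0 x : (0 <= p_mass x)%E.
Proof.
by rewrite p_massE; apply: nneseries_ge0 => n _ _; rewrite lee_fin powR_ge0.
Qed.

Lemma p_massD x y : (p_mass (fun n => x n + y n)%R `^ p^-1 <=
  p_mass x `^ p^-1 + p_mass y `^ p^-1)%E.
Proof.
have h n : 0 <= rnorm (x n) + rnorm (y n) by rewrite addr_ge0 ?rnorm_ge0.
rewrite !p_massE; apply: le_trans; last first.
  by apply: minkowski_series => // n; exact: rnorm_ge0.
apply: gt0_ler_poweR; rewrite ?invr_ge0 ?(le_trans _ p1)//.
- by rewrite in_itv /= leey -p_massE p_mass_ge0.
- rewrite in_itv /= leey andbT.
  by apply: nneseries_ge0 => n _ _; rewrite lee_fin powR_ge0.
apply: lee_nneseries => n _; first by rewrite lee_fin powR_ge0.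
rewrite lee_fin ge0_ler_powR ?nnegrE ?rnorm_ge0 ?(le_trans _ p1)//.
exact: ler_rnormD.
Qed.

Lemma p_massZ (a : K) x :
  p_mass (fun n => a *: x n) = ((rnorm (a : K^o) `^ p)%:E * p_mass x)%E.
Proof.
rewrite !p_massE -nneseriesZl; last by move=> n _; rewrite lee_fin powR_ge0.
by apply: eq_eseriesr => n _; rewrite rnormZ powRM ?rnorm_ge0// EFinM.
Qed.

Lemma p_mass0 : p_mass (fun n => 0 : X n) = 0%E.
Proof.
rewrite p_massE eseries0// => n _ _; rewrite rnorm0 powR0//.
by rewrite gt_eqF// (lt_le_trans _ p1).
Qed.

Lemma p_massN x : p_mass (fun n => - x n) = p_mass x.
Proof.
by rewrite !p_massE; apply: eq_eseriesr => n _; rewrite /rnorm normrN.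
Qed.

Lemma p_mass_eq0 x : p_mass x = 0%E -> forall n, x n = 0.
Proof.
move=> x0 n; apply: rnorm0_eq0; apply/eqP.
have := @nneseries_lim_ge R (fun n => (rnorm (x n) `^ p)%:E) xpredT 0 n.+1.
rewrite -p_massE x0 big_nat_recr //= => /(_ (fun _ _ _ => _)) h.
have {h} : ((rnorm (x n) `^ p)%:E <= 0 :> \bar R)%E.
  apply: (le_trans _ (h _)); last by move=> *; rewrite lee_fin powR_ge0.
  by rewrite leeDr// sume_ge0// => i _; rewrite lee_fin powR_ge0.
rewrite lee_fin => h; have /eqP : rnorm (x n) `^ p = 0.
  by apply/le_anti; rewrite h powR_ge0.
by rewrite powR_eq0 => /andP[].
Qed.

End p_mass.

Record lp_sum (R : realType) (k : scalar_kind)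
    (X : nat -> normedModType (scalar_field R k)) (p : R) (p1 : 1 <= p) := LpSum {
  lp_fun :> forall n, X n;
  lp_fun_finite : (p_mass p lp_fun < +oo)%E
}.

Section lp_sum_normed.
Variables (R : realType) (k : scalar_kind).
Local Notation K := (scalar_field R k).
Variables (X : nat -> normedModType K) (p : R) (p1 : 1 <= p).
Local Notation T := (lp_sum X p1).
Implicit Types x y z : T.

HB.instance Definition _ := gen_eqMixin T.
HB.instance Definition _ := gen_choiceMixin T.

Lemma lp_sumP x y : (forall n, x n = y n) -> x = y.
Proof.
case: x y => [x hx] [y hy] /= xy.
have {}xy : x = y by exact: functional_extensionality_dep.
by case: y / xy hy => hy; congr LpSum; exact: Prop_irrelevance.
Qed.

Let p0 : p != 0. Proof. by rewrite gt_eqF// (lt_le_trans _ p1). Qed.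

Lemma lp_add_finite x y : (p_mass p (fun n => x n + y n)%R < +oo)%E.
Proof.
apply: (@lty_poweRy _ _ p^-1); first by rewrite invr_eq0.
apply: (le_lt_trans (p_massD p1 x y)).
by rewrite lte_add_pinfty// poweR_lty// lp_fun_finite.
Qed.

Lemma lp_opp_finite x : (p_mass p (fun n => - x n)%R < +oo)%E.
Proof. by rewrite p_massN lp_fun_finite. Qed.

Lemma lp_scale_finite (a : K) x : (p_mass p (fun n => a *: x n)%R < +oo)%E.
Proof.
by rewrite p_massZ lte_mul_pinfty ?lp_fun_finite// lee_fin powR_ge0.
Qed.

Lemma lp_zero_finite : (p_mass p (fun n => 0%R : X n) < +oo)%E.
Proof. by rewrite p_mass0. Qed.

Definition lp_zero : T := LpSum p1 lp_zero_finite.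
Definition lp_add x y : T := LpSum p1 (lp_add_finite x y).
Definition lp_opp x : T := LpSum p1 (lp_opp_finite x).
Definition lp_scale (a : K) x : T := LpSum p1 (lp_scale_finite a x).

Let lp_addA : associative lp_add.
Proof. by move=> x y z; apply: lp_sumP => n /=; rewrite addrA. Qed.

Let lp_addC : commutative lp_add.
Proof. by move=> x y; apply: lp_sumP => n /=; rewrite addrC. Qed.

Let lp_add0 : left_id lp_zero lp_add.
Proof. by move=> x; apply: lp_sumP => n /=; rewrite add0r. Qed.

Let lp_addN : left_inverse lp_zero lp_opp lp_add.
Proof. by move=> x; apply: lp_sumP => n /=; rewrite addNr. Qed.

HB.instance Definition _ :=
  GRing.isZmodule.Build T lp_addA lp_addC lp_add0 lp_addN.

Let lp_scaleA (a b : K) x : lp_scale a (lp_scale b x) = lp_scale (a * b) x.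
Proof. by apply: lp_sumP => n /=; rewrite scalerA. Qed.

Let lp_scale1 : left_id 1 lp_scale.
Proof. by move=> x; apply: lp_sumP => n /=; rewrite scale1r. Qed.

Let lp_scaleDr : right_distributive lp_scale +%R.
Proof. by move=> a x y; apply: lp_sumP => n /=; rewrite scalerDr. Qed.

Let lp_scaleDl x : {morph lp_scale^~ x : a b / a + b}.
Proof. by move=> a b; apply: lp_sumP => n /=; rewrite scalerDl. Qed.

HB.instance Definition _ :=
  GRing.Zmodule_isLmodule.Build K T lp_scaleA lp_scale1 lp_scaleDr lp_scaleDl.

Fact lp_norm_key : unit. Proof. exact: tt. Qed.
Definition lp_norm : T -> R :=
  locked_with lp_norm_key (fun x => fine (p_mass p x) `^ p^-1).

Lemma lp_normE x : (lp_norm x)%:E = (p_mass p x `^ p^-1)%E.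
Proof.
rewrite /lp_norm unlock -poweR_EFin fineK// ge0_fin_numE ?p_mass_ge0//.
exact: lp_fun_finite.
Qed.

Let lp_normD x y :
  scalar_of k (lp_norm (x + y)) <=
  scalar_of k (lp_norm x) + scalar_of k (lp_norm y).
Proof.
have h : lp_norm (x + y) <= lp_norm x + lp_norm y.
  by rewrite -lee_fin EFinD !lp_normE; exact: (p_massD p1 x y).
by rewrite -[leRHS]scalar_ofD ler_scalar_of.
Qed.

Let lp_normZ (a : K) x :
  scalar_of k (lp_norm (a *: x)) = `|a| * scalar_of k (lp_norm x).
Proof.
rewrite -[`|a|](Rescalar_norm (a : K^o)) -scalar_ofM; congr (scalar_of k _).
apply: EFin_inj; rewrite EFinM !lp_normE p_massZ poweRM ?p_mass_ge0//.
  by rewrite poweR_EFin -powRrM divff// powRr1// rnorm_ge0.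
by rewrite lee_fin powR_ge0.
Qed.

Let lp_norm_eq0 x : scalar_of k (lp_norm x) = 0 -> x = 0.
Proof.
move=> h; have h0 : lp_norm x = 0.
  by apply: (@scalar_of_inj R k); rewrite h scalar_of0.
have x0 : p_mass p x = 0%E.
  by apply: (@poweR_eq0_eq0 _ _ p^-1); rewrite ?p_mass_ge0// -lp_normE h0.
by apply: lp_sumP => n; rewrite (p_mass_eq0 x0).
Qed.

HB.instance Definition _ :=
  @Lmodule_isNormed.Build K T (fun x => scalar_of k (lp_norm x))
    lp_normD lp_normZ lp_norm_eq0.

Lemma rnorm_lp x :
  rnorm x = fine (\sum_(n <oo) (rnorm (x n) `^ p)%:E)%E `^ p^-1.
Proof.
rewrite -p_massE; apply: (@scalar_of_inj R k); rewrite Rescalar_norm.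
by rewrite [in RHS](_ : _ `^ _ = lp_norm x) // /lp_norm unlock.
Qed.

End lp_sum_normed.

Section notions.
Variables (R : realType) (k : scalar_kind).
Local Notation K := (scalar_field R k).
Variable X : normedModType K.
Implicit Types (A B S : set X) (x a y : X).

Definition unit_ball : set X := [set x | `|x| <= 1].

(* For A nonempty and bounded the supremum is finite and the slice is nonempty;
   f = 0 yields A, which an open half-space also cuts out when X is nonzero. *)
Definition slice A (f : X -> K^o) (alpha : R) : set X :=
  [set x | A x /\ sup [set Rescalar (f b) | b in A] - alpha < Rescalar (f x)].

Definition is_slice A S :=
  exists (f : {linear X -> K^o}) (alpha : R),
    [/\ continuous f, 0 < alpha & S = slice A f alpha].

Definition conv B : set X := smallest (@convex_set K X) B.

Definition determining A a (V : nat -> set X) :=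
  (forall n, V n !=set0 /\ V n `<=` A) /\
  forall B, B `<=` A -> (forall n, B `&` V n !=set0) -> closure (conv B) a.

Definition SCD A : set X :=
  [set a | A a /\
    exists V : nat -> set X, (forall n, is_slice A (V n)) /\ determining A a V].

Definition opnorm (T : X -> X) : R := sup [set rnorm (T x) | x in unit_ball].

Definition bounded_op (T : X -> X) :=
  exists M : K, forall x, `|T x| <= M * `|x|.

Definition rank_one (T : X -> X) :=
  exists2 y, y != 0 & range T = range (fun c : K => c *: y).

Definition daugavet :=
  forall T : {linear X -> X}, bounded_op T -> rank_one T ->
    opnorm (fun x => x + T x) = 1 + opnorm T.

End notions.

Arguments unit_ball {R k} X.
Arguments daugavet {R k} X.

(* Main.v *)
Require Import Defs.
From HB Require Import structures.
From mathcomp Require Import all_boot all_order all_algebra.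
From mathcomp Require Import all_classical all_reals all_analysis.
From mathcomp Require Import complex ring lra.

Set Implicit Arguments.
Unset Strict Implicit.
Unset Printing Implicit Defensive.

Import Order.TTheory GRing.Theory Num.Theory.
Import numFieldNormedType.Exports.

Local Open Scope classical_set_scope.
Local Open Scope ring_scope.

(** Write [B] for the unit ball of the [l_p]-sum.

    The point 0 is an SCD point because [p > 1].  By Hahn-Banach each
    [X n] carries a nonzero continuous functional; composed with the [n]-th
    coordinate it defines a slice of [B] that can be taken so thin that each of
    its points is, up to an error [2^-n], supported on the coordinate [n].
    If a set meets all these slices, the mean of the first [N] points chosen
    in it has norm at most [(N^(1/p) + 2) / N], which tends to 0
    ([lp_sum_points_le], [powR_mean_small], [zero_SCD]).

    A point [a] with [a m != 0] is not an SCD point because of the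
    Daugavet property of [X m].  Applied to the operators [x |-> - f(x) z] with
    [f] of norm 1, that property yields, for every nonzero [z] and in every
    slice of the unit ball of [X m], a point [x] with [|z - x|] almost
    [|z| + 1] ([daugavet_slice]).
    Iterating this along a sequence of slices, with [z] the current value of
    [a m - x_0 - ... - x_(n-1)], gives points with
    [|a m - s_n| >= |a m| / 2 + n], where [s_n = x_0 + ... + x_(n-1)]
    ([daugavet_sequence]).  The closed balls of centre [s_n] and radius [n]
    increase with [n], so their union is convex; it contains each segment
    from 0 to [x_n] and stays at distance at least [|a m| / 2]
    from [a m].

    Given any sequence of slices of [B], pick a point [b_n] in each and
    replace its [m]-th coordinate by [|b_n m| x_n], where [x_n] comes from the
    slice that the restriction of the [n]-th functional to [X m] cuts out.
    The new point is still in [B] and in the [n]-th slice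
    ([slice_replace_coord]), while the [m]-th coordinates of all convex
    combinations of new points remain in the union of balls.  Hence [a] is
    not in their closed convex hull ([nonzero_coord_not_SCD]). *)

(** * Real scalars, real parts and real-valued norms *)

Section Scalars.
Variables (R : realType) (k : scalar_kind).
Local Notation K := (scalar_field R k).
Implicit Types (a b : R) (z w : K).

Lemma scalar_of1 : scalar_of k 1 = 1 :> K.
Proof. by case: k. Qed.

Lemma scalar_ofN a : scalar_of k (- a) = - scalar_of k a.
Proof. by apply/eqP; rewrite -addr_eq0 -scalar_ofD addNr scalar_of0. Qed.

Lemma scalar_ofK a : Rescalar (scalar_of k a) = a.
Proof. by case: k. Qed.

Lemma RescalarD z w : Rescalar (z + w) = Rescalar z + Rescalar w.
Proof. by case: k z w => //= -[? ?] [? ?]. Qed.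

Lemma RescalarZ a z : Rescalar (scalar_of k a * z) = a * Rescalar z.
Proof. by case: k z => //= -[? ?] /=; rewrite mul0r subr0. Qed.

Lemma Rescalar0 : Rescalar (0 : K) = 0.
Proof. by case: k. Qed.

Lemma RescalarB z w : Rescalar (z - w) = Rescalar z - Rescalar w.
Proof. by rewrite -mulN1r -scalar_of1 -scalar_ofN RescalarD RescalarZ mulN1r. Qed.

Lemma Rescalar_le_rnorm z : Rescalar z <= rnorm (z : K^o).
Proof.
rewrite /rnorm; case: k z => [|[a b]] /=; first exact: ler_norm.
rewrite -[leRHS]/(Num.sqrt (a ^+ 2 + b ^+ 2)).
rewrite (le_trans (ler_norm a))// -sqrtr_sqr ler_wsqrtr// lerDl sqr_ge0//.
Qed.

Lemma rnorm_scalar_of a : rnorm (scalar_of k a : K^o) = `|a|.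
Proof.
apply: (@scalar_of_inj R k); rewrite Rescalar_norm.
wlog a0 : a / 0 <= a.
  move=> h; have [/h//|/ltW a0] := leP 0 a.
  by rewrite -normrN -scalar_ofN h ?oppr_ge0// normrN.
by rewrite !ger0_norm// -[0](scalar_of0 R k) ler_scalar_of.
Qed.

Lemma ler_rnorm_scalar (X : normedModType K) (x : X) a :
  (rnorm x <= a) = (`|x| <= scalar_of k a).
Proof. by rewrite -Rescalar_norm ler_scalar_of. Qed.

Lemma ltr_scalar_of a b : (scalar_of k a < scalar_of k b) = (a < b).
Proof.
by rewrite !lt_neqAle ler_scalar_of (inj_eq (@scalar_of_inj R k)).
Qed.

Lemma ltr_rnorm_scalar (X : normedModType K) (x : X) a :
  (rnorm x < a) = (`|x| < scalar_of k a).
Proof. by rewrite -Rescalar_norm ltr_scalar_of. Qed.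

Lemma unit_ballE (X : normedModType K) (x : X) : unit_ball X x <-> rnorm x <= 1.
Proof. by rewrite ler_rnorm_scalar scalar_of1. Qed.

Lemma scalar_ge0P z : 0 <= z -> exists2 a, 0 <= a & z = scalar_of k a.
Proof.
move=> z0; exists (rnorm (z : K^o)); first exact: rnorm_ge0.
by rewrite Rescalar_norm ger0_norm.
Qed.

(** This lets the real and the complex case share proofs: a scalar can be
    rotated onto the nonnegative reals without changing norms. *)
Lemma unimodular_rotation z :
  exists2 u : K, rnorm (u : K^o) = 1 & u * z = scalar_of k (rnorm (z : K^o)).
Proof.
have [->|z0] := eqVneq z 0.
  by exists 1; [rewrite -scalar_of1 rnorm_scalar_of normr1|
    rewrite mulr0 rnorm0 scalar_of0].
exists (`|z| / z); last by rewrite divfK// Rescalar_norm.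
apply: (@scalar_of_inj R k).
by rewrite Rescalar_norm normrM normfV normr_id divff ?normr_eq0// scalar_of1.
Qed.

Variable X : normedModType K.
Implicit Types (x y : X) (f : {linear X -> K^o}).

Lemma rnormN x : rnorm (- x) = rnorm x.
Proof. by rewrite /rnorm normrN. Qed.

Lemma rnormB x y : rnorm (x - y) = rnorm (y - x).
Proof. by rewrite -rnormN opprB. Qed.

Lemma rnorm_gt0 x : x != 0 -> 0 < rnorm x.
Proof.
move=> x0; rewrite lt_neqAle rnorm_ge0 andbT eq_sym.
by apply: contra_neq x0; exact: rnorm0_eq0.
Qed.

Lemma rnorm_scale a x : 0 <= a -> rnorm (scalar_of k a *: x) = a * rnorm x.
Proof. by move=> a0; rewrite rnormZ rnorm_scalar_of ger0_norm. Qed.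

Lemma functional_ReZ f a x :
  Rescalar (f (scalar_of k a *: x)) = a * Rescalar (f x).
Proof. by rewrite linearZ RescalarZ. Qed.

Lemma functional_rotate f x : exists2 u : K, rnorm (u : K^o) = 1 &
  f (u *: x) = scalar_of k (rnorm (f x)).
Proof.
have [u u1 uE] := unimodular_rotation (f x).
by exists u => //; rewrite linearZ.
Qed.

(** Rotating [x] turns [f x] into its norm, so a bound on the real part of a
    functional is already a bound on its norm. *)
Lemma functional_norm_le_Re f (M : R) :
  (forall x, Rescalar (f x) <= M * rnorm x) ->
  forall x, rnorm (f x) <= M * rnorm x.
Proof.
move=> fM x; have [u u1 uE] := functional_rotate f x.
by have := fM (u *: x); rewrite uE scalar_ofK rnormZ u1 mul1r.
Qed.

Lemma functional_continuousP f : continuous f <->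
  exists2 M : R, 0 < M & forall x, rnorm (f x) <= M * rnorm x.
Proof.
split=> [cf|[M M0 fM]].
  have /linear_boundedP/pinfty_ex_gt0[M M0 fM] :=
    proj2 (linear_bounded_continuous f) cf.
  have [a a0 aM] := scalar_ge0P (ltW M0).
  exists a; first by rewrite -ltr_scalar_of -aM scalar_of0.
  by move=> x; rewrite -(@ler_scalar_of R k) scalar_ofM !Rescalar_norm -aM.
apply/linear_bounded_continuous/linear_boundedP; exists (scalar_of k M); split.
  by apply: ger0_real; rewrite -(scalar_of0 R k) ler_scalar_of ltW.
move=> r /ltW Mr x; apply: le_trans (ler_wpM2r (normr_ge0 x) Mr).
by rewrite -!Rescalar_norm -scalar_ofM ler_scalar_of.
Qed.

End Scalars.

(** * The Hahn-Banach theorem for real and complex scalars *)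

Section Sublinear.
Variables (R : realType) (k : scalar_kind).
Local Notation K := (scalar_field R k).
Variable X : normedModType K.
Implicit Types (x y : X) (q r : X -> R).
Local Notation "t *r x" := (scalar_of k t *: x) (at level 40).

(** The inequality [q (t *r x) <= t * q x] suffices: applied to [t^-1] it gives
    the converse ([sublinearZ]). *)
Definition sublinear q :=
  (forall x y, q (x + y) <= q x + q y) /\
  (forall t x, 0 <= t -> q (t *r x) <= t * q x).

Lemma rscaleA s t x : s *r (t *r x) = (s * t) *r x.
Proof. by rewrite scalerA scalar_ofM. Qed.

Lemma sublinear_rnorm : sublinear (@rnorm R k X).
Proof.
by split=> [x y|t x t0]; [exact: ler_rnormD|rewrite rnorm_scale].
Qed.

Lemma sublinearZ q t x : sublinear q -> 0 <= t -> q (t *r x) = t * q x.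
Proof.
move=> [qD qZ]; rewrite le_eqVlt => /predU1P[<-|t0].
  apply/le_anti; rewrite qZ// mul0r scalar_of0 scale0r.
  by have := qD 0 0; rewrite addr0; lra.
apply/le_anti; rewrite qZ ?(ltW t0)//= -ler_pdivlMl//.
have := qZ t^-1 (t *r x); rewrite rscaleA mulVf ?gt_eqF// scalar_of1 scale1r.
by apply; rewrite invr_ge0 ltW.
Qed.

Lemma sublinear_geN q x : sublinear q -> - q (- x) <= q x.
Proof.
move=> sq; have [qD _] := sq; have := qD x (- x).
have := sublinearZ 0 sq (lexx 0); rewrite scaler0 mul0r subrr => ->; lra.
Qed.

(** The largest sublinear functional below [q] that takes at [- y] a value at
    most [- q y].  That [shave q y = q] for every [y] is what makes a minimal
    [q] additive. *)
Definition shave q y x := inf [set q (x + t *r y) - t * q y | t in [set t | 0 <= t]].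

Lemma shave_le q y x t : sublinear q -> 0 <= t ->
  shave q y x <= q (x + t *r y) - t * q y.
Proof.
move=> sq t0; apply: ge_inf; last by exists t.
exists (- q (- x)) => _ [s s0 <-]; rewrite -(sublinearZ y sq s0).
have [qD _] := sq; have := qD (- x) (x + s *r y); rewrite addrA addNr add0r; lra.
Qed.

Lemma shave_ge q y x (m : R) :
  (forall t, 0 <= t -> m <= q (x + t *r y) - t * q y) -> m <= shave q y x.
Proof.
move=> mq; apply: lb_le_inf; first by eexists; exists 0 => /=.
by move=> _ [t t0 <-]; exact: mq.
Qed.

Lemma sublinear_shave q y : sublinear q -> sublinear (shave q y).
Proof.
move=> sq; have [qD qZ] := sq; split.
  move=> x x'; rewrite -lerBlDr; apply: shave_ge => t t0.
  rewrite lerBlDl -lerBlDr; apply: shave_ge => t' t'0; rewrite lerBlDr.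
  apply: le_trans (shave_le _ _ sq (addr_ge0 t0 t'0)) _.
  have := qD (x + t *r y) (x' + t' *r y).
  by rewrite scalar_ofD scalerDl addrACA; lra.
move=> t x; rewrite le_eqVlt => /predU1P[<-|t0].
  rewrite mul0r; apply: le_trans (shave_le _ _ sq (lexx 0)) _.
  rewrite mul0r subr0 scalar_of0 !scale0r addr0.
  by have := sublinearZ 0 sq (lexx 0); rewrite scaler0 mul0r => ->.
rewrite -ler_pdivrMl//; apply: shave_ge => s s0; rewrite ler_pdivrMl//.
apply: le_trans (shave_le _ _ sq (mulr_ge0 (ltW t0) s0)) _.
by rewrite -rscaleA -scalerDr sublinearZ ?(ltW t0)// mulrBr mulrA.
Qed.

Lemma shave_below q y x : sublinear q -> shave q y x <= q x.
Proof.
move=> sq; apply: le_trans (shave_le _ _ sq (lexx 0)) _.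
by rewrite mul0r subr0 scalar_of0 !scale0r addr0.
Qed.

Lemma shaveN q y : sublinear q -> shave q y (- y) <= - q y.
Proof.
move=> sq; apply: le_trans (shave_le _ _ sq ler01) _.
rewrite scalar_of1 scale1r addNr mul1r.
by have := sublinearZ 0 sq (lexx 0); rewrite scaler0 mul0r => ->; rewrite sub0r.
Qed.

(** Zorn's lemma: the pointwise infimum of a chain of sublinear functionals is
    sublinear, and it is finite because a sublinear [r] below [q] satisfies
    [- q (- x) <= r x]. *)
Lemma minimal_sublinear q : sublinear q -> exists r, [/\ sublinear r,
  (forall x, r x <= q x) &
  (forall r', sublinear r' -> (forall x, r' x <= r x) -> r' = r)].
Proof.
move=> sq; pose T := {r | sublinear r /\ forall x, r x <= q x}.
pose below (r r' : T) := `[< forall x, sval r' x <= sval r x >].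
have [|||A Atot|[r [sr rq]] rmin] := @Zorn T below.
- by move=> r; apply/asboolP.
- move=> r s t /asboolP rs /asboolP st; apply/asboolP => x.
  exact: le_trans (st x) (rs x).
- move=> [r ?] [s ?] /asboolP rs /asboolP sr; apply: eq_exist; apply/funext => x.
  by apply/le_anti; rewrite rs sr.
- have [[r0 Ar0]|A0] := pselect (A !=set0); last first.
    have qT : sublinear q /\ forall x, q x <= q x by split.
    by exists (exist _ q qT) => s As; exfalso; apply: A0; exists s.
  pose m x := inf [set sval r x | r in A].
  have m_le (r : T) x : A r -> m x <= sval r x.
    move=> Ar; apply: ge_inf; last by exists r.
    exists (- q (- x)) => _ [s As <-]; have [ss sq'] := svalP s.
    by have := sublinear_geN x ss; have := sq' (- x); lra.
  have m_ge x c : (forall r : T, A r -> c <= sval r x) -> c <= m x.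
    move=> cA; apply: lb_le_inf; first by exists (sval r0 x), r0.
    by move=> _ [r Ar <-]; exact: cA.
  have sm : sublinear m.
    split=> [x y|t x].
      rewrite -lerBlDr; apply: (m_ge) => r Ar.
      rewrite lerBlDl -lerBlDr; apply: (m_ge) => s As; rewrite lerBlDr.
      have [/asboolP rs|/asboolP sr] := Atot _ _ Ar As.
        have [[sD _] _] := svalP s.
        apply: le_trans (m_le s _ As) _.
        by have := sD x y; have := rs y; have := rs x; lra.
      have [[rD _] _] := svalP r.
      apply: le_trans (m_le r _ Ar) _.
      by have := rD x y; have := sr y; have := sr x; lra.
    rewrite le_eqVlt => /predU1P[<-|t0].
      have [sr _] := svalP r0; apply: le_trans (m_le _ _ Ar0) _.
      by rewrite sublinearZ// !mul0r.
    rewrite -ler_pdivrMl//; apply: (m_ge) => r Ar; rewrite ler_pdivrMl//.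
    have [sr _] := svalP r; apply: le_trans (m_le _ _ Ar) _.
    by rewrite sublinearZ// ltW.
  have mq x : m x <= q x.
    by have [_ r0q] := svalP r0; exact: le_trans (m_le _ _ Ar0) (r0q x).
  by exists (exist _ m (conj sm mq)) => s As; apply/asboolP => x; exact: m_le.
exists r; split=> // r' sr' r'r.
have r'q x : r' x <= q x by exact: le_trans (r'r x) (rq x).
pose t' : T := exist _ r' (conj sr' r'q).
by apply: (congr1 sval (rmin t' _)); apply/asboolP.
Qed.

(** Minimality forces [shave r y = r]; evaluating the infimum at [t = 1] gives
    [r x <= r (x + y) - r y]. *)
Lemma minimal_sublinearD r x y : sublinear r ->
  (forall r', sublinear r' -> (forall x, r' x <= r x) -> r' = r) ->
  r (x + y) = r x + r y.
Proof.
move=> sr rmin; have [rD _] := sr; apply/le_anti; rewrite rD /=.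
have rE := rmin _ (sublinear_shave y sr) (fun x => shave_below y x sr).
have := shave_le y x sr ler01; rewrite rE scalar_of1 scale1r mul1r; lra.
Qed.

(** A minimal sublinear functional below [shave rnorm x0] is linear over the
    reals, and shaving forces its value at [- x0] to be at most
    [- rnorm x0]. *)
Lemma real_hahn_banach (x0 : X) : exists f : X -> R,
  [/\ {morph f : x y / x + y}, (forall t x, f (t *r x) = t * f x),
   (forall x, f x <= rnorm x) & rnorm x0 <= f x0].
Proof.
have sN := sublinear_rnorm.
have [f [sf fq fmin]] := minimal_sublinear (sublinear_shave x0 sN).
have fD x y : f (x + y) = f x + f y by exact: minimal_sublinearD.
have f0 : f 0 = 0 by have := fD 0 0; rewrite addr0; lra.
have fN x : f (- x) = - f x by have := fD x (- x); rewrite subrr f0; lra.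
exists f; split=> //.
- move=> t x; have [t0|/ltW t0] := leP 0 t; first by rewrite sublinearZ.
  have := sublinearZ x sf (_ : 0 <= - t); rewrite oppr_ge0 => /(_ t0).
  by rewrite scalar_ofN scaleNr fN; lra.
- by move=> x; exact: le_trans (fq x) (shave_below _ _ sN).
- by have := le_trans (fq (- x0)) (shaveN _ sN); rewrite fN lerN2.
Qed.

End Sublinear.

(** A real-linear [f] is the real part of the complex-linear functional
    [x |-> f x - i f (i x)]. *)
Lemma complexify (R : realType) (X : normedModType R[i]) (f : X -> R) :
  {morph f : x y / x + y} ->
  (forall t x, f ((t +i* 0)%C *: x) = t * f x) ->
  exists F : {linear X -> (R[i])^o}, forall x, complex.Re (F x) = f x.
Proof.
move=> fD fZ; pose F x : (R[i])^o := (f x +i* - f ('i%C *: x))%C.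
have FL : linear F.
  move=> [a b] x y; rewrite /F.
  have E : (a +i* b)%C = (a +i* 0)%C + (b +i* 0)%C * 'i%C :> R[i].
    by apply/eqP; rewrite eq_complex /=; apply/andP; split; apply/eqP; ring.
  have fab z : f ((a +i* b)%C *: z) = a * f z + b * f ('i%C *: z).
    by rewrite E scalerDl fD -scalerA !fZ.
  have fii : f ('i%C *: ('i%C *: x)) = - f x.
    rewrite scalerA; have -> : ('i * 'i)%C = (-1 +i* 0)%C :> R[i].
      by apply/eqP; rewrite eq_complex /=; apply/andP; split; apply/eqP; ring.
    by rewrite fZ mulN1r.
  rewrite scalerDr !fD scalerA (mulrC 'i%C) -scalerA !fab fii.
  by apply/eqP; rewrite eq_complex /=; apply/andP; split; apply/eqP; ring.
pose L := GRing.isLinear.Build R[i] X (R[i])^o *:%R F FL.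
pose FF : {linear X -> (R[i])^o} := HB.pack F L.
by exists FF.
Qed.

Lemma hahn_banach (R : realType) (k : scalar_kind)
    (X : normedModType (scalar_field R k)) (x0 : X) :
  exists f : {linear X -> (scalar_field R k)^o},
    continuous f /\ rnorm x0 <= Rescalar (f x0).
Proof.
have [f [fD fZ fle fx0]] := real_hahn_banach x0.
have [F FE] : exists F : {linear X -> (scalar_field R k)^o},
    forall x, Rescalar (F x) = f x.
  case: k X x0 f fD fZ {fle fx0} => [X x0 f fD fZ|X x0 f fD fZ].
    have fL : linear (f : X -> R^o) by move=> a x y; rewrite fD fZ.
    pose L := GRing.isLinear.Build R X R^o *:%R f fL.
    pose F : {linear X -> R^o} := HB.pack f L.
    by exists F.
  exact: complexify.
exists F; split; last by rewrite FE.
apply/functional_continuousP; exists 1 => //; apply: functional_norm_le_Re => x.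
by rewrite FE mul1r.
Qed.

(** * Suprema over the unit ball, closures and convex hulls *)

Section BallSup.
Variables (R : realType) (k : scalar_kind).
Local Notation K := (scalar_field R k).
Variable X : normedModType K.
Implicit Types (x y a : X) (g : X -> R) (A B : set X).
Local Notation "t *r x" := (scalar_of k t *: x) (at level 40).

(** Both [opnorm T] and the supremum in a slice of the unit ball unfold to an
    instance of this. *)
Definition ball_sup g : R := sup [set g x | x in unit_ball X].

Lemma unit_ball0 : unit_ball X 0.
Proof. by apply/unit_ballE; rewrite rnorm0. Qed.

Lemma ball_sup_le g (M : R) :
  (forall x, rnorm x <= 1 -> g x <= M) -> ball_sup g <= M.
Proof.
move=> gM; apply: ge_sup; first by exists (g 0), 0 => //; exact: unit_ball0.
by move=> _ [x /unit_ballE x1 <-]; exact: gM.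
Qed.

Lemma has_ball_sup g (M : R) : (forall x, rnorm x <= 1 -> g x <= M) ->
  has_sup [set g x | x in unit_ball X].
Proof.
move=> gM; split; first by exists (g 0), 0 => //; exact: unit_ball0.
by exists M => _ [x /unit_ballE x1 <-]; exact: gM.
Qed.

Lemma ball_sup_ge g (M : R) x : (forall x, rnorm x <= 1 -> g x <= M) ->
  rnorm x <= 1 -> g x <= ball_sup g.
Proof.
move=> /has_ball_sup gM x1; apply: ub_le_sup; first by case: gM.
by exists x => //; apply/unit_ballE.
Qed.

Lemma ball_sup_adherent g (M e : R) : (forall x, rnorm x <= 1 -> g x <= M) ->
  0 < e -> exists2 x, rnorm x <= 1 & ball_sup g - e < g x.
Proof.
move=> /has_ball_sup gM e0; have [_ [x /unit_ballE x1 <-] xe] :=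
  sup_adherent e0 gM.
by exists x.
Qed.

Lemma closure_rnormP A a : closure A a <->
  forall e : R, 0 < e -> exists2 y, A y & rnorm (a - y) < e.
Proof.
split=> [clA e e0|clA U].
  have : nbhs a (ball a (scalar_of k e)).
    by apply: nbhsx_ballx; rewrite -(scalar_of0 R k) ltr_scalar_of.
  move=> /clA[y [Ay]]; rewrite -ball_normE /= -ltr_rnorm_scalar; by exists y.
move=> /nbhs_normP[e /= e0 eU].
have [r r0 rE] := scalar_ge0P (ltW e0).
have [|y Ay ye] := clA r; first by rewrite -(@ltr_scalar_of R k) -rE scalar_of0.
by exists y; split=> //; apply: eU; rewrite /ball_ /= rE -ltr_rnorm_scalar.
Qed.

Lemma convex_setP A : convex_set A <-> forall (t : R) x y, 0 <= t <= 1 ->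
  A x -> A y -> A (t *r x + (1 - t) *r y).
Proof.
split=> [cA t x y /andP[t0 t1] Ax Ay|cA x y l].
  have l01 : 0 <= scalar_of k t <= 1.
    by rewrite -(scalar_of0 R k) -(scalar_of1 R k) !ler_scalar_of t0.
  have /(_ (Itv01 (proj1 (andP l01)) (proj2 (andP l01)))) := cA x y _.
  rewrite !inE => /(_ Ax Ay).
  by rewrite /conv /= scalar_ofD scalar_ofN scalar_of1.
rewrite !inE => Ax Ay.
have [t t0 tE] := scalar_ge0P (ge0 l : 0 <= l%:num).
have t1 : t <= 1 by rewrite -(@ler_scalar_of R k) -tE scalar_of1 le1.
have := cA t x y; rewrite t0 t1 => /(_ isT Ax Ay).
by rewrite scalar_ofD scalar_ofN scalar_of1 -tE.
Qed.

Lemma conv_mean B (b : nat -> X) n : (forall i, B (b i)) ->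
  Defs.conv B (n.+1%:R^-1 *r \sum_(i < n.+1) b i).
Proof.
move=> Bb M [/convex_setP Mconv BM]; elim: n => [|n IH].
  by rewrite big_ord1 invr1 scalar_of1 scale1r; exact: BM.
pose t : R := n.+1%:R / n.+2%:R.
have t01 : 0 <= t <= 1.
  by rewrite divr_ge0//= ler_pdivrMr// mul1r ler_nat.
have := Mconv t _ _ t01 IH (BM _ (Bb n.+1)).
rewrite rscaleA; have -> : t * n.+1%:R^-1 = n.+2%:R^-1.
  by rewrite /t mulrAC divff// mul1r.
have -> : 1 - t = n.+2%:R^-1.
  have n0 : n.+2%:R != 0 :> R by rewrite pnatr_eq0.
  by apply: (mulIf n0); rewrite mulrBl divfK// mulVf// mul1r -natrB// subSnn.
by rewrite -scalerDr [\sum_(i < n.+2) _]big_ord_recr.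
Qed.

End BallSup.

(** * Consequences of the Daugavet property *)

Section DaugavetSlices.
Variables (R : realType) (k : scalar_kind).
Local Notation K := (scalar_field R k).
Variable Y : normedModType K.
Hypothesis dY : daugavet Y.
Implicit Types (x y z a : Y) (f : {linear Y -> K^o}).
Local Notation "t *r x" := (scalar_of k t *: x) (at level 40).

Lemma rank_one_op f y : exists T : {linear Y -> Y}, forall x, T x = f x *: y.
Proof.
pose T x := f x *: y.
have TL : linear T.
  by move=> c u v; rewrite /T linearD linearZ scalerDl scalerA.
pose L := GRing.isLinear.Build K Y Y *:%R T TL.
by exists (HB.pack T L : {linear Y -> Y}).
Qed.

(** Let [s] be the norm of [f]; the operator is [T x = - (f x / s) z], of norm
    [rnorm z].  A point [x] at which [x + T x] almost attains the norm
    [1 + rnorm z] can be rotated so that [t = f x / s] is in [[0, 1]].  Then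
    [|x - t z|] is almost [1 + rnorm z], which forces [t] to be close to 1,
    so that [x] is in the slice, and [x - t z] to be close to [x - z]. *)
Lemma daugavet_slice f z (alpha e : R) : continuous f -> z != 0 ->
  0 < alpha -> 0 < e ->
  exists2 x, slice (unit_ball Y) f alpha x & rnorm z + 1 - e <= rnorm (z - x).
Proof.
move=> /functional_continuousP[M M0 fM] z0 alpha0 e0.
have nz : 0 < rnorm z by exact: rnorm_gt0.
have fball x : rnorm x <= 1 -> rnorm (f x) <= M.
  by move=> x1; rewrite (le_trans (fM x))// ler_piMr// ltW.
(* For [f = 0] the slice is the whole ball, and [- z / |z|] is as far from [z]
   as possible. *)
have [[w fw]|f0] := pselect (exists w, f w != 0); last first.
  have {}f0 x : f x = 0.
    by apply/eqP/negP => /negP fx; apply: f0; exists x.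
  exists (- ((rnorm z)^-1 *r z)).
    split.
      apply/unit_ballE; rewrite rnormN rnorm_scale ?invr_ge0 ?(ltW nz)//.
      by rewrite mulVf// gt_eqF.
    rewrite f0 Rescalar0 subr_lt0.
    apply: le_lt_trans alpha0; apply: (ball_sup_le (g := fun x => Rescalar (f x))).
    by move=> x _; rewrite f0 Rescalar0.
  rewrite opprK -{2}[z]scale1r -scalar_of1 -scalerDl -scalar_ofD rnorm_scale.
    by rewrite mulrDl mul1r mulVf ?gt_eqF//; lra.
  by rewrite addr_ge0// invr_ge0 ltW.
pose s := ball_sup (fun x => rnorm (f x)).
have fs x : rnorm x <= 1 -> rnorm (f x) <= s.
  exact: (ball_sup_ge (g := fun x => rnorm (f x)) fball).
have s0 : 0 < s.
  have w0 : w != 0 by apply: contra_neq fw => ->; rewrite linear0.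
  have nw := rnorm_gt0 w0.
  apply: lt_le_trans (fs ((rnorm w)^-1 *r w) _); last first.
    by rewrite rnorm_scale ?invr_ge0 ?(ltW nw)// mulVf// gt_eqF.
  rewrite linearZ /= -[_ *: _]/(_ *: (f w : K^o)) rnorm_scale ?invr_ge0 ?(ltW nw)//.
  by rewrite mulr_gt0 ?invr_gt0// rnorm_gt0.
have [T TE] := rank_one_op f (- (s^-1 *r z)).
have nT x : rnorm (T x) = rnorm (f x) * (rnorm z / s).
  by rewrite TE rnormZ rnormN rnorm_scale ?invr_ge0 ?(ltW s0)// (mulrC s^-1).
have Tball x : rnorm x <= 1 -> rnorm (T x) <= M * (rnorm z / s).
  by move=> x1; rewrite nT ler_wpM2r ?fball// divr_ge0// ltW.
have Tbnd : bounded_op T.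
  exists (scalar_of k (M * (rnorm z / s))) => x.
  rewrite -!Rescalar_norm -scalar_ofM ler_scalar_of nT mulrAC.
  by rewrite ler_wpM2r ?fM// divr_ge0// ltW.
have y0 : - (s^-1 *r z) != 0.
  rewrite oppr_eq0 scaler_eq0 negb_or z0 andbT.
  by rewrite -(scalar_of0 R k) (inj_eq (@scalar_of_inj R k)) invr_eq0 gt_eqF.
have Trank : rank_one T.
  exists (- (s^-1 *r z)) => //; apply/seteqP; split=> _ [c _ <-].
    by rewrite TE; exists (f c).
  exists ((c / f w) *: w) => //.
  by rewrite TE linearZ /= -[_ *: f w]/(_ * _) divfK.
(* The first bound controls the distance to [z], the second makes
   [1 - t < alpha / s], that is, puts [x] in the slice. *)
pose eta := Num.min (e / 2) (alpha * rnorm z / s).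
have eta0 : 0 < eta by rewrite lt_min !divr_gt0 ?mulr_gt0.
have opT : rnorm z - eta / 2 <= opnorm T.
  have d0 : 0 < eta / 2 * (s / rnorm z) by rewrite mulr_gt0 ?divr_gt0.
  have [x x1 xs] := ball_sup_adherent fball d0.
  have : rnorm (T x) <= opnorm T.
    exact: (ball_sup_ge (g := fun x => rnorm (T x)) Tball).
  apply: le_trans; rewrite nT -ler_pdivrMr ?divr_gt0//.
  apply: le_trans (ltW xs); rewrite -/s invf_div mulrBl.
  by rewrite [_ * (s / _)]mulrC divfK// gt_eqF.
have idT x : rnorm x <= 1 -> rnorm (x + T x) <= 1 + M * (rnorm z / s).
  by move=> x1; rewrite (le_trans (ler_rnormD _ _))// lerD// Tball.
have e20 : 0 < eta / 2 by rewrite divr_gt0.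
have [x1 x11] := ball_sup_adherent idT e20.
rewrite -[ball_sup _]/(opnorm (fun x => x + T x)) dY// => x1T.
have [u u1 uE] := functional_rotate f x1.
pose x := u *: x1; pose t := rnorm (f x1) / s.
have xb : rnorm x <= 1 by rewrite rnormZ u1 mul1r.
have fx : Rescalar (f x) = t * s by rewrite uE scalar_ofK divfK// gt_eqF.
have t0 : 0 <= t by rewrite divr_ge0 ?rnorm_ge0// ltW.
have t1 : t <= 1 by rewrite ler_pdivrMr// mul1r fs.
have xT : 1 + rnorm z - eta < rnorm (x - t *r z).
  have -> : x - t *r z = u *: (x1 + T x1).
    rewrite scalerDr -linearZ TE uE scalerN rscaleA; congr (_ - _).
  rewrite rnormZ u1 mul1r; lra.
have tz : (1 - t) * rnorm z < eta.
  have := le_trans (ler_rnormD x (- (t *r z))) (_ : _ <= 1 + t * rnorm z).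
  rewrite rnormN rnorm_scale// => /(_ (lerD xb (lexx _))); lra.
exists x.
  split; first exact/unit_ballE.
  rewrite fx; apply: (@le_lt_trans _ _ (s - alpha)).
    rewrite lerD2r; apply: (ball_sup_le (g := fun x => Rescalar (f x))) => y y1.
    exact: le_trans (Rescalar_le_rnorm _) (fs y y1).
  have : (1 - t) * rnorm z < alpha * rnorm z / s.
    by apply: lt_le_trans tz _; rewrite ge_min lexx orbT.
  rewrite ltr_pdivlMr// mulrAC ltr_pM2r//; lra.
have xtz : x - t *r z = (x - z) + (1 - t) *r z.
  by rewrite scalar_ofD scalar_ofN scalar_of1 scalerBl scale1r addrA subrK.
have := ler_rnormD (x - z) ((1 - t) *r z).
rewrite -xtz rnorm_scale ?subr_ge0// (rnormB z).
have : eta <= e / 2 by rewrite ge_min lexx.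
lra.
Qed.

End DaugavetSlices.

Section DaugavetCone.
Variables (R : realType) (k : scalar_kind).
Local Notation K := (scalar_field R k).
Variable Y : normedModType K.
Hypothesis dY : daugavet Y.
Implicit Types (x y z a : Y).
Local Notation "t *r x" := (scalar_of k t *: x) (at level 40).

(** The induction applies [daugavet_slice] to [z = a - x_0 - ... - x_(n-1)],
    which is nonzero because its norm is at least [rnorm a / 2 + n]; the losses
    [rnorm a / 2^(n+2)] of the first steps never exceed [rnorm a / 2] in total. *)
Lemma daugavet_sequence (f : nat -> {linear Y -> K^o}) (alpha : nat -> R) a :
  (forall n, continuous (f n)) -> (forall n, 0 < alpha n) -> a != 0 ->
  exists x : nat -> Y,
    (forall n, slice (unit_ball Y) (f n) (alpha n) (x n)) /\
    (forall n, rnorm a / 2 + n%:R <= rnorm (a - \sum_(i < n) x i)).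
Proof.
move=> cf alpha0 a0; have na := rnorm_gt0 a0.
pose e n : R := rnorm a / 2 / 2 ^+ n.
have e0 n : 0 < e n by rewrite !divr_gt0// exprn_gt0.
have /choice[g gP] : forall nz : nat * Y, exists x, nz.2 != 0 ->
    slice (unit_ball Y) (f nz.1) (alpha nz.1) x /\
    rnorm nz.2 + 1 - e nz.1.+1 <= rnorm (nz.2 - x).
  move=> [n z] /=; have [->|z0] := eqVneq z 0; first by exists 0.
  by have [x] := daugavet_slice dY (cf n) z0 (alpha0 n) (e0 n.+1); exists x.
pose Z := fix Z n := if n is n'.+1 then Z n' - g (n', Z n') else a.
have Zn n : rnorm a / 2 + e n + n%:R <= rnorm (Z n).
  elim: n => [|n IH]; first by rewrite /e expr0 divr1 addr0 -splitr.
  have Zn0 : Z n != 0.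
    apply: contraTneq IH => ->; rewrite rnorm0 -ltNge.
    by rewrite ltr_wpDr// addr_gt0// divr_gt0.
  have [_] := gP (n, Z n) Zn0; rewrite /= -(natr1 n).
  have -> : e n.+1 = e n / 2 by rewrite /e exprSr invfM mulrA.
  lra.
exists (fun n => g (n, Z n)); split=> n.
  have Zn0 : Z n != 0.
    apply: contraTneq (Zn n) => ->; rewrite rnorm0 -ltNge.
    by rewrite ltr_wpDr// addr_gt0// divr_gt0.
  by have [] := gP (n, Z n) Zn0.
have -> : a - \sum_(i < n) g (i : nat, Z i) = Z n.
  by elim: n => [|n IH]; rewrite ?big_ord0 ?subr0// big_ord_recr opprD addrA IH.
by apply: le_trans (Zn n); rewrite lerD2r lerDl ltW.
Qed.

(** For [x] in the unit ball the balls of centre [x_0 + ... + x_(n-1)] and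
    radius [n] increase, so their union is convex.  A point [a] at
    distance at least [c + n] from the [n]-th centre, for every [n], is at
    distance at least [c] from the union. *)
Definition growing_balls (x : nat -> Y) : set Y :=
  [set y | exists n, rnorm (y - \sum_(i < n) x i) <= n%:R].

Section GrowingBalls.
Variable x : nat -> Y.
Hypothesis x1 : forall n, rnorm (x n) <= 1.

Lemma growing_balls_mono y m n : (m <= n)%N ->
  rnorm (y - \sum_(i < m) x i) <= m%:R -> rnorm (y - \sum_(i < n) x i) <= n%:R.
Proof.
move=> /subnK <-; elim: (n - m)%N => // d IH /IH{}IH.
rewrite addSn big_ord_recr opprD addrA -natr1.
by rewrite (le_trans (ler_rnormD _ _))// lerD// rnormN.
Qed.

Lemma growing_balls_convex : convex_set (growing_balls x).
Proof.
apply/convex_setP => t u v /andP[t0 t1] [m um] [n vn].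
exists (maxn m n); move: (\sum_(i < _) _) (growing_balls_mono (leq_maxl m n) um)
  (growing_balls_mono (leq_maxr m n) vn) => c uc vc.
have -> : t *r u + (1 - t) *r v - c = t *r (u - c) + (1 - t) *r (v - c).
  rewrite !scalerBr addrACA -opprD -scalerDl -scalar_ofD [t + _]addrC subrK.
  by rewrite scalar_of1 scale1r.
rewrite (le_trans (ler_rnormD _ _))// !rnorm_scale ?subr_ge0//.
have t1' : 0 <= 1 - t by rewrite subr_ge0.
have := ler_wpM2l t0 uc; have := ler_wpM2l t1' vc; lra.
Qed.

Lemma growing_balls_segment (t : R) n : 0 <= t <= 1 -> growing_balls x (t *r x n).
Proof.
move=> /andP[t0 t1]; exists n.+1; rewrite rnormB big_ord_recr /=.
rewrite -addrA -(natr1 n) (le_trans (ler_rnormD _ _))// lerD//.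
  elim: n => [|n IH]; first by rewrite big_ord0 rnorm0.
  by rewrite big_ord_recr -(natr1 n) (le_trans (ler_rnormD _ _))// lerD.
rewrite -[X in X - _]scale1r -scalar_of1 -scalerBl -scalar_ofN -scalar_ofD.
by rewrite rnorm_scale ?subr_ge0// mulr_ile1 ?subr_ge0 ?rnorm_ge0//; lra.
Qed.

Lemma growing_balls_dist a c :
  (forall n, c + n%:R <= rnorm (a - \sum_(i < n) x i)) ->
  forall y, growing_balls x y -> c <= rnorm (a - y).
Proof.
move=> ac y [n yn]; have := ler_rnormD (a - y) (y - \sum_(i < n) x i).
by rewrite addrA subrK; have := ac n; lra.
Qed.

End GrowingBalls.

End DaugavetCone.

(** * Coordinates of an l_p-sum *)

Lemma powR_le_cancel (R : realType) (p x y : R) :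
  0 < p -> 0 <= x -> 0 <= y -> x `^ p <= y `^ p -> x <= y.
Proof.
move=> p0 x0 y0; apply: contraTT; rewrite -!ltNge => yx.
by apply: gt0_ltr_powR; rewrite ?nnegrE.
Qed.

Section LpSum.
Variables (R : realType) (k : scalar_kind).
Local Notation K := (scalar_field R k).
Variables (X : nat -> normedModType K) (p : R) (p1 : 1 <= p).
Local Notation E := (lp_sum X p1).
Implicit Types (m n : nat) (b c : E).

Let p_gt0 : 0 < p. Proof. exact: lt_le_trans ltr01 p1. Qed.

Lemma lp_normX b : (rnorm b `^ p)%:E = p_mass p b.
Proof.
rewrite rnorm_lp -p_massE -powRrM mulVf ?gt_eqF// powRr1; last first.
  by rewrite fine_ge0// p_mass_ge0.
by rewrite fineK// ge0_fin_numE ?p_mass_ge0// lp_fun_finite.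
Qed.

Lemma lp_coordD m b c : (b + c) m = b m + c m. Proof. by []. Qed.
Lemma lp_coordN m b : (- b) m = - b m. Proof. by []. Qed.
Lemma lp_coordZ m t b : (t *: b) m = t *: b m. Proof. by []. Qed.

Fact lp_single_finite m (y : X m) :
  (p_mass p (eqtype.dfwith (fun n => 0%R : X n) y) < +oo)%E.
Proof.
rewrite p_massE (nneseriesD1 (n := m))//; last first.
  by move=> i _; rewrite lee_fin powR_ge0.
rewrite eseries0 ?adde0 ?ltry// => i _ /= im.
by rewrite dfwith_out 1?eq_sym// rnorm0 powR0// gt_eqF.
Qed.

Definition lp_single m (y : X m) : E := LpSum p1 (lp_single_finite y).

Lemma lp_single_in m (y : X m) : lp_single y m = y.
Proof. exact: dfwith_in. Qed.

Lemma lp_single_out m n (y : X m) : m != n -> lp_single y n = 0.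
Proof. exact: dfwith_out. Qed.

Lemma lp_single_linear m : linear (@lp_single m).
Proof.
move=> t x y; apply: lp_sumP => n; rewrite lp_coordD lp_coordZ.
have [mn|mn] := eqVneq m n; last by rewrite !lp_single_out// scaler0 addr0.
by case: n / mn; rewrite !lp_single_in.
Qed.

HB.instance Definition _ m :=
  GRing.isLinear.Build K (X m) E *:%R (@lp_single m) (@lp_single_linear m).

(** The norm estimates below come from this identity rather than from the
    series: removing a coordinate removes its [p]-th power. *)
Lemma lp_norm_split b m :
  rnorm b `^ p = rnorm (b m) `^ p + rnorm (b - lp_single (b m)) `^ p.
Proof.
apply: EFin_inj; rewrite EFinD !lp_normX !p_massE.
have pos (c : E) : forall i, xpredT i -> (0 <= (rnorm (c i) `^ p)%:E :> \bar R)%E.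
  by move=> i _; rewrite lee_fin powR_ge0.
rewrite (nneseriesD1 (n := m) (pos b))// [in RHS](nneseriesD1 (n := m) (pos _))//.
rewrite lp_coordD lp_coordN lp_single_in subrr rnorm0 powR0 ?gt_eqF// add0e.
congr (_ + _)%E; rewrite eseries_cond [RHS]eseries_cond.
apply: eq_eseriesr => i /andP[/andP[_ im] _].
by rewrite lp_coordD lp_coordN lp_single_out 1?eq_sym// subr0.
Qed.

Lemma rnorm_lp_single m (y : X m) : rnorm (lp_single y) = rnorm y.
Proof.
apply: (powR_injective p_gt0); rewrite ?nnegrE ?rnorm_ge0//.
by rewrite (lp_norm_split _ m) lp_single_in subrr rnorm0 powR0 ?gt_eqF// addr0.
Qed.

Lemma rnorm_coord_le m b : rnorm (b m) <= rnorm b.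
Proof.
apply: (@powR_le_cancel _ p); rewrite ?rnorm_ge0//.
by rewrite (lp_norm_split b m) lerDl powR_ge0.
Qed.

Lemma lp_replace_coord_le m b (y : X m) : rnorm y <= rnorm (b m) ->
  rnorm (b + lp_single (y - b m)) <= rnorm b.
Proof.
move=> yb; apply: (@powR_le_cancel _ p); rewrite ?rnorm_ge0//.
rewrite (lp_norm_split b m) (lp_norm_split (b + _) m) lp_coordD lp_single_in.
rewrite [b m + _]addrC subrK.
rewrite linearB /=.
have -> : b + (lp_single y - lp_single (b m)) - lp_single y = b - lp_single (b m).
  by rewrite addrA addrAC addrK.
by rewrite lerD2r ge0_ler_powR ?nnegrE ?rnorm_ge0// ltW.
Qed.

Lemma lp_singles_norm (y : forall n, X n) n : (forall i, rnorm (y i) <= 1) ->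
  rnorm (\sum_(i < n) lp_single (y i)) <= n%:R `^ p^-1.
Proof.
move=> y1; apply: (@powR_le_cancel _ p); rewrite ?rnorm_ge0 ?powR_ge0//.
rewrite -powRrM mulVf ?gt_eqF// powRr1//.
have v0 m j : (j <= m)%N -> (\sum_(i < j) lp_single (y i)) m = 0.
  elim: j => [|j IH] jm; first by rewrite big_ord0.
  by rewrite big_ord_recr lp_coordD IH ?(ltnW jm)// add0r lp_single_out// ltn_eqF.
elim: n => [|n IH]; first by rewrite big_ord0 rnorm0 powR0// gt_eqF.
rewrite (lp_norm_split _ n) big_ord_recr lp_coordD lp_single_in v0// add0r addrK.
rewrite -natr1 addrC lerD//.
have e1 : 1 = 1 `^ p :> R by rewrite powR1.
rewrite [leRHS]e1.
by rewrite ge0_ler_powR ?nnegrE ?rnorm_ge0// ltW.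
Qed.

End LpSum.

(** * A point with a nonzero coordinate is not an SCD point *)

Section LpScd.
Variables (R : realType) (k : scalar_kind).
Local Notation K := (scalar_field R k).
Variables (X : nat -> normedModType K) (p : R) (p1 : 1 <= p).
Local Notation E := (lp_sum X p1).
Implicit Types (m n : nat) (a b c : E).
Local Notation "t *r x" := (scalar_of k t *: x) (at level 40).

Lemma ball_sup_functional (Y : normedModType K) (f : {linear Y -> K^o}) y :
  continuous f ->
  Rescalar (f y) <= ball_sup (fun x : Y => Rescalar (f x)) * rnorm y.
Proof.
move=> /functional_continuousP[M M0 fM].
have [->|y0] := eqVneq y 0; first by rewrite linear0 Rescalar0 rnorm0 mulr0.
have ny := rnorm_gt0 y0; rewrite -ler_pdivrMr// mulrC -functional_ReZ.
apply: (ball_sup_ge (g := fun x => Rescalar (f x)) (M := M)) => [x x1|].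
  apply: le_trans (Rescalar_le_rnorm _) _; apply: le_trans (fM x) _.
  by rewrite ler_piMr// ltW.
by rewrite rnorm_scale ?invr_ge0 ?(ltW ny)// mulVf// gt_eqF.
Qed.

Lemma single_comp_continuous m (f : {linear E -> K^o}) : continuous f ->
  continuous (f \o @lp_single R k X p p1 m).
Proof.
move=> /functional_continuousP[M M0 fM]; apply/functional_continuousP.
by exists M => // x; rewrite -(rnorm_lp_single p1 x); exact: fM.
Qed.

(** With [g] the functional induced by [f] on [X m] and [S] the supremum of
    its real part on the unit ball, [Re g (b m) <= |b m| S].  As [x] is
    almost optimal for [g], the replacement lowers [Re f b] by at most
    [|b m|] times half of the margin by which [b] lies in the slice. *)
Lemma slice_replace_coord m (f : {linear E -> K^o}) (alpha : R) b (x : X m) :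
  continuous f -> slice (unit_ball E) f alpha b ->
  slice (unit_ball (X m)) (f \o @lp_single R k X p p1 m)
    ((Rescalar (f b) - (ball_sup (fun b => Rescalar (f b)) - alpha)) / 2) x ->
  slice (unit_ball E) f alpha (b + lp_single p1 (rnorm (b m) *r x - b m)).
Proof.
move=> cf [/unit_ballE b1 fb] [/unit_ballE x1 gx].
rewrite -[sup _]/(ball_sup (fun b => Rescalar (f b))) in fb.
set s := ball_sup _ in fb gx.
have t0 := rnorm_ge0 (b m); have t1 := le_trans (rnorm_coord_le m b) b1.
have tx : rnorm (rnorm (b m) *r x) <= rnorm (b m).
  by rewrite rnorm_scale// ler_piMr.
split; first exact/unit_ballE/(le_trans (lp_replace_coord_le tx) b1).
have cg := single_comp_continuous (m := m) cf.
have /= gb := ball_sup_functional (f := f \o @lp_single R k X p p1 m) (b m) cg.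
rewrite -[sup _]/s linearD RescalarD linearB linearB RescalarB.
have -> : Rescalar (f (lp_single p1 (rnorm (b m) *r x))) =
    rnorm (b m) * Rescalar (f (lp_single p1 x)).
  exact: (functional_ReZ (f \o @lp_single R k X p p1 m)).
rewrite -[sup _]/(ball_sup (fun x => Rescalar (f (lp_single p1 x)))) in gx.
move: gb gx; rewrite /=; set S := ball_sup _; nra.
Qed.

Lemma nonzero_coord_not_SCD m a : daugavet (X m) -> a m != 0 ->
  ~ SCD (unit_ball E) a.
Proof.
move=> dX am [a1 [V [Vslice [Vsub Vdet]]]].
have /choice[b Vb] : forall n, exists b, V n b by move=> n; have [] := Vsub n.
have /choice[fa faP] : forall n, exists fa : {linear E -> K^o} * R,
    [/\ continuous fa.1, 0 < fa.2 & V n = slice (unit_ball E) fa.1 fa.2].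
  by move=> n; have [f [alpha H]] := Vslice n; exists (f, alpha).
pose g n : {linear X m -> K^o} := (fa n).1 \o @lp_single R k X p p1 m.
pose beta n := (Rescalar ((fa n).1 (b n)) -
  (ball_sup (fun b => Rescalar ((fa n).1 b)) - (fa n).2)) / 2.
have beta0 n : 0 < beta n.
  have [_ _ VE] := faP n; have := Vb n; rewrite VE => -[_].
  by move=> h; rewrite divr_gt0// subr_gt0.
have cg n : continuous (g n).
  by have [cf _ _] := faP n; exact: single_comp_continuous.
have [x [xslice xdist]] := daugavet_sequence dX cg beta0 am.
have x1 n : rnorm (x n) <= 1 by have [/unit_ballE] := xslice n.
pose b' n : E := b n + lp_single p1 (rnorm (b n m) *r x n - b n m).
have b'm n : b' n m = rnorm (b n m) *r x n.
  by rewrite lp_coordD lp_single_in addrC subrK.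
have Vb' n : V n (b' n).
  have [cf _ VE] := faP n; rewrite VE; apply: slice_replace_coord => //.
    by rewrite -VE.
  exact: xslice.
have /closure_rnormP clB : closure (Defs.conv (range b')) a.
  apply: Vdet => [_ [i _ <-]|j]; first by have [_] := Vsub i; apply.
  by exists (b' j); split=> //; exists j.
have am2 : 0 < rnorm (a m) / 2 by rewrite divr_gt0// rnorm_gt0.
have [y By ay] := clB _ am2.
have yC : growing_balls x (y m).
  have := By; apply: (smallest_sub (X := [set y : E | growing_balls x (y m)])).
    apply/convex_setP => t u v t01 um vm /=.
    have /convex_setP := growing_balls_convex x1; exact.
  move=> _ [n _ <-]; change (growing_balls x (b' n m)); rewrite b'm.
  apply: (growing_balls_segment x1); rewrite rnorm_ge0/=.
  apply: le_trans (rnorm_coord_le _ _) _; apply/unit_ballE.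
  by have [_ _ VE] := faP n; have := Vb n; rewrite VE => -[].
have := growing_balls_dist xdist yC; rewrite leNgt => /negP; apply.
exact: le_lt_trans (rnorm_coord_le m (a - y)) ay.
Qed.

End LpScd.

(** * The origin is an SCD point *)

Section ZeroScd.
Variables (R : realType) (k : scalar_kind).
Local Notation K := (scalar_field R k).
Variables (X : nat -> normedModType K) (p : R) (p1 : 1 <= p).
Local Notation E := (lp_sum X p1).
Implicit Types (m n : nat) (a b c : E).
Local Notation "t *r x" := (scalar_of k t *: x) (at level 40).

Definition lp_coord m b : X m := b m.

Lemma lp_coord_linear m : linear (lp_coord m).
Proof. by []. Qed.

HB.instance Definition _ m :=
  GRing.isLinear.Build K E (X m) *:%R (lp_coord m) (@lp_coord_linear m).

(** When the coordinate [b n] already carries a [p]-th power of at least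
    [1 - d^p], only [d^p] is left for the others. *)
Lemma lp_rest_small b n (d : R) : rnorm b <= 1 -> 0 <= d <= 1 ->
  (1 - d `^ p) `^ p^-1 <= rnorm (b n) -> rnorm (b - lp_single p1 (b n)) <= d.
Proof.
have p0 : 0 < p by exact: lt_le_trans ltr01 p1.
move=> b1 /andP[d0 d1] cb; apply: (powR_le_cancel p0); rewrite ?rnorm_ge0//.
have e1 : 1 = 1 `^ p :> R by rewrite powR1.
have dp1 : d `^ p <= 1 by rewrite [leRHS]e1 ge0_ler_powR ?nnegrE// ltW.
have : 1 - d `^ p <= rnorm (b n) `^ p.
  have := ge0_ler_powR (ltW p0) (powR_ge0 _ _) (rnorm_ge0 (b n)) cb.
  by rewrite -powRrM mulVf ?gt_eqF// powRr1// subr_ge0.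
have : rnorm b `^ p <= 1.
  by rewrite [leRHS]e1 ge0_ler_powR ?nnegrE ?rnorm_ge0// ltW.
by rewrite (lp_norm_split b n); lra.
Qed.

(** The parts on the diagonal have disjoint supports, which gives
    [n^(1/p)] in place of [n]; the other parts are summed as a geometric
    series. *)
Lemma lp_sum_points_le (b : nat -> E) n : (forall i, rnorm (b i) <= 1) ->
  (forall i, rnorm (b i - lp_single p1 (b i i)) <= 2^-1 ^+ i) ->
  rnorm (\sum_(i < n) b i) <= n%:R `^ p^-1 + 2.
Proof.
move=> b1 br.
have -> : \sum_(i < n) b i = \sum_(i < n) lp_single p1 (b i i) +
    \sum_(i < n) (b i - lp_single p1 (b i i)).
  by rewrite -big_split; apply: eq_bigr => i _; rewrite [RHS]addrC subrK.
rewrite (le_trans (ler_rnormD _ _))// lerD//.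
  apply: (lp_singles_norm p1 (y := fun i => b i i)) => i.
  exact: le_trans (rnorm_coord_le _ _) (b1 i).
suff : rnorm (\sum_(i < n) (b i - lp_single p1 (b i i))) <= 2 - 2 * 2^-1 ^+ n.
  by have : 0 <= 2^-1 ^+ n :> R; [rewrite exprn_ge0|lra].
elim: n => [|n IH]; first by rewrite big_ord0 rnorm0 expr0; lra.
rewrite big_ord_recr; apply: le_trans (ler_rnormD _ _) _.
by have := br n; rewrite exprS; lra.
Qed.

(** With [q = 1 - 1/p > 0], the two terms are [N^(-q)] and [2 / N]; each is made
    smaller than [e / 2]. *)
Lemma powR_mean_small (e : R) : 1 < p -> 0 < e ->
  exists n, n.+1%:R^-1 * (n.+1%:R `^ p^-1 + 2) < e.
Proof.
move=> p1' e0; have p0 : 0 < p by exact: lt_trans ltr01 p1'.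
pose q := 1 - p^-1; have q0 : 0 < q by rewrite subr_gt0 invf_lt1.
have e20 : 0 < 2 / e by rewrite divr_gt0.
pose x := Num.max ((2 / e) `^ q^-1) (4 / e).
have x0 : 0 <= x by rewrite le_max powR_ge0.
exists (Num.bound x); set n := Num.bound x.
have xn : x < n.+1%:R by apply: lt_trans (archi_boundP x0) _; rewrite ltr_nat.
have N0 : 0 < n.+1%:R :> R by [].
have nq : 2 / e < n.+1%:R `^ q.
  have -> : 2 / e = (2 / e) `^ q^-1 `^ q.
    by rewrite -powRrM mulVf ?gt_eqF// powRr1// ltW.
  apply: gt0_ltr_powR; rewrite ?nnegrE ?powR_ge0//.
  by apply: le_lt_trans xn; rewrite le_max lexx.
have ne : 4 / e < n.+1%:R by apply: le_lt_trans xn; rewrite le_max lexx orbT.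
have nE : n.+1%:R `^ p^-1 * n.+1%:R `^ q = n.+1%:R.
  have pq : p^-1 + q = 1 by rewrite /q [LHS]addrC subrK.
  by rewrite -powRD ?pq ?powRr1 ?implybT//; rewrite gt_eqF ?implybT.
set N : R := n.+1%:R in N0 nq ne nE *; rewrite ltr_pdivrMl//.
move: nq ne; rewrite !ltr_pdivrMr// => nq ne.
have r0 : 0 < N `^ p^-1 by rewrite powR_gt0.
set r := N `^ p^-1 in nE r0 *; set t := N `^ q in nE nq *.
have : r * 2 < N * e by rewrite -nE -mulrA ltr_pM2l.
lra.
Qed.

Lemma zero_SCD : 1 < p -> (forall n, exists x : X n, x != 0) ->
  SCD (unit_ball E) 0.
Proof.
move=> p1' X0; split; first exact: unit_ball0.
have p0 : 0 < p by exact: lt_trans ltr01 p1'.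
have /choice[F FP] : forall n, exists F : {linear E -> K^o}, [/\ continuous F,
    (forall b, F b = F (lp_single p1 (b n))) & exists b, 0 < Rescalar (F b)].
  move=> n; have [x0 x00] := X0 n; have [f [cf fx0]] := hahn_banach x0.
  exists (f \o lp_coord n); split.
  - move: cf => /functional_continuousP[M M0 fM]; apply/functional_continuousP.
    exists M => // b; apply: le_trans (fM _) _.
    by rewrite ler_pM2l// rnorm_coord_le.
  - by move=> b; rewrite -[RHS]/(f (lp_single p1 (b n) n)) lp_single_in.
  - exists (lp_single p1 x0).
    rewrite -[X in Rescalar X]/(f (lp_single p1 x0 n)) lp_single_in.
    exact: lt_le_trans (rnorm_gt0 x00) fx0.
pose s n := ball_sup (fun b => Rescalar (F n b)).
have s0 n : 0 < s n.
  have [cF _ [b Fb]] := FP n; have := ball_sup_functional b cF.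
  rewrite -/(s n); move: (rnorm_ge0 b) => b0 sb.
  rewrite ltNge; apply/negP => sn; have := mulr_le0_ge0 sn b0; lra.
(* A slice of depth [s n * (1 - c n)] contains only points whose coordinate [n]
   has norm larger than [c n], the threshold of [lp_rest_small] for
   [d = 2^-n]. *)
pose c n : R := (1 - (2^-1 ^+ n) `^ p) `^ p^-1.
have c1 n : c n < 1.
  have d0 : 0 < (2^-1 ^+ n) `^ p :> R by rewrite powR_gt0 ?exprn_gt0.
  have d1 : 0 <= (2^-1 : R) ^+ n <= 1.
    by rewrite exprn_ge0//= exprn_ile1//; lra.
  have e1 r : 1 = 1 `^ r :> R by rewrite powR1.
  rewrite /c [ltRHS](e1 p^-1); apply: gt0_ltr_powR; rewrite ?invr_gt0 ?nnegrE//.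
    have [? ?] := andP d1.
    by rewrite subr_ge0 [leRHS](e1 p) ge0_ler_powR ?nnegrE// ltW.
pose alpha n := s n * (1 - c n).
have alpha0 n : 0 < alpha n by rewrite mulr_gt0 ?subr_gt0.
exists (fun n => slice (unit_ball E) (F n) (alpha n)); split.
  by move=> n; have [cF _ _] := FP n; exists (F n), (alpha n).
split=> [n|B B1 BV].
  split=> [|b []//]; have [cF _ _] := FP n.
  have /functional_continuousP[M M0 FM] := cF.
  have FM1 b : rnorm b <= 1 -> Rescalar (F n b) <= M.
    move=> b1; apply: le_trans (Rescalar_le_rnorm _) _.
    by apply: le_trans (FM b) _; rewrite ler_piMr// ltW.
  have [b b1 bs] := ball_sup_adherent FM1 (alpha0 n).
  by exists b; split=> //; exact/unit_ballE.
have /choice[b bP] : forall n, exists b,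
    B b /\ slice (unit_ball E) (F n) (alpha n) b.
  by move=> n; have [b []] := BV n; exists b.
have b1 n : rnorm (b n) <= 1 by have [/B1/unit_ballE] := bP n.
have br n : rnorm (b n - lp_single p1 (b n n)) <= 2^-1 ^+ n.
  apply: lp_rest_small => //.
    by rewrite exprn_ge0//= exprn_ile1//; lra.
  have [cF FE _] := FP n; have [_ [_]] := bP n.
  rewrite -[sup _]/(s n) FE => sF.
  have := ball_sup_functional (lp_single p1 (b n n)) cF.
  rewrite -/(s n) rnorm_lp_single => Fs.
  have : s n * c n < s n * rnorm (b n n).
    by apply: lt_le_trans Fs; move: sF; rewrite /alpha; lra.
  by rewrite ltr_pM2l// => /ltW.
apply/closure_rnormP => e e0; have [n ne] := powR_mean_small p1' e0.
exists (n.+1%:R^-1 *r \sum_(i < n.+1) b i).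
  by apply: conv_mean => i; have [] := bP i.
rewrite sub0r rnormN rnorm_scale ?invr_ge0//.
by apply: le_lt_trans ne; rewrite ler_wpM2l ?invr_ge0// lp_sum_points_le.
Qed.

End ZeroScd.

Theorem theorem3p6 (R : realType) (k : scalar_kind)
  (X : nat -> completeNormedModType (scalar_field R k)) (p : R) (p1 : 1 < p)
  (X_neq0 : forall n, exists x : X n, x != 0)
  (X_daugavet : forall n, daugavet (X n)) :
  SCD (unit_ball (lp_sum (fun n => X n) (ltW p1))) = [set 0].
Proof.
apply/seteqP; split=> [a aSCD|_ ->]; last exact: zero_SCD.
apply: lp_sumP => n; apply/eqP/negP => /negP an.
exact: (nonzero_coord_not_SCD (X_daugavet n) an aSCD).
Qed.
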